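(* Let $\alpha\in\mathbb{C}$ with $|\alpha|\le 1$ and $\alpha\notin\{-1,1\}$, let $n\ge 3$ be an integer, and let $1\le j\le n$. Then the number $\vartheta_{\alpha,n,j}=g^{-1}(\lambda_{\alpha,n,j})$ satisfies $$\vartheta_{\alpha,n,j}=\frac{j\pi+\eta_{\alpha,j}(\vartheta_{\alpha,n,j})}{n}.$$
   Context: For $\alpha\in\mathbb{C}$ and an integer $n\ge 3$, $A_{\alpha,n}$ is the $n\times n$ complex matrix with all main diagonal entries equal to $2$, all entries on the first subdiagonal and on the first superdiagonal equal to $-1$, the $(1,n)$ entry equal to $-\overline{\alpha}$, the $(n,1)$ entry equal to $-\alpha$, and all other entries $0$. It is Hermitian, and its (real) eigenvalues, counted with multiplicity, are enumerated in ascending order: $\lambda_{\alpha,n,1}\le\cdots\le\lambda_{\alpha,n,n}$. The function $g(x)=4\sin^2(x/2)$ is a strictly increasing bijection $[0,\pi]\to[0,4]$, and $g^{-1}\colon[0,4]\to[0,\pi]$ is its inverse; for the $\alpha$ considered here all eigenvalues of $A_{\alpha,n}$ lie in $(0,4)$, so $\vartheta_{\alpha,n,j}$ is well defined. For $\alpha\in\mathbb{C}\setminus\{-1,1\}$ put $k_\alpha=\frac{1-|\alpha|^2}{|1+\alpha|^2}$, $l_\alpha=\frac{|1-\alpha|}{|1+\alpha|}$, and for every integer $j$ define $\eta_{\alpha,j}\colon[0,\pi]\to\mathbb{R}$ by $$\eta_{\alpha,j}(x)=-2\arctan\left(\left((-1)^{j+1}k_\alpha\cot(x)+\sqrt{k_\alpha^2\cot^2(x)+l_\alpha^2}\right)^{(-1)^j}\right)$$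 for $x\in(0,\pi)$, with the values at $x=0$ and $x=\pi$ understood as one-sided limits. *)

(* Defs.v *)
From HB Require Import structures.
From mathcomp Require Export all_boot all_order all_algebra.
From mathcomp Require Export all_classical all_reals all_analysis.
From mathcomp Require Export complex.

Set Implicit Arguments.
Unset Strict Implicit.
Unset Printing Implicit Defensive.

Import Order.TTheory GRing.Theory Num.Theory.
Import numFieldNormedType.Exports.

Local Open Scope classical_set_scope.
Local Open Scope complex_scope.
Local Open Scope ring_scope.

(* Row and column indices start at 0; for n >= 3 the branches are disjoint. *)
Definition Amx (R : realType) (alpha : R[i]) (n : nat) : 'M[R[i]]_n :=
  \matrix_(i < n, j < n)
    if i == j then 2
    else if ((i.+1 == j) || (j.+1 == i))%N then -1
    else if ((i == 0 :> nat) && (j == n.-1 :> nat))%N then - alpha^*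
    else if ((i == n.-1 :> nat) && (j == 0 :> nat))%N then - alpha
    else 0.

(* The ascending list of eigenvalues of M, each repeated according to its
   multiplicity as a root of the characteristic polynomial. Such a list is
   unique, and it exists exactly when all complex eigenvalues of M are real, in
   particular when M is Hermitian; otherwise the value is the empty list. *)
Definition real_eigenvalues (R : realType) (n : nat) (M : 'M[R[i]]_n) : seq R :=
  xget [::] [set s : seq R | sorted <=%R s /\
                             char_poly M = \prod_(x <- s) ('X - (x%:C)%:P)].

(* The eigenvalues are numbered from 1. *)
Definition lambda (R : realType) (alpha : R[i]) (n j : nat) : R :=
  nth 0 (real_eigenvalues (Amx alpha n)) j.-1.

Definition g (R : realType) (x : R) : R := 4 * sin (x / 2) ^+ 2.

(* The inverse of g : [0, pi] -> [0, 4]; the value outside [0, 4] is 0. *)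
Definition ginv (R : realType) : R -> R :=
  'pinv_(fun=> 0) [set x : R | 0 <= x <= pi] (@g R).

Definition vartheta (R : realType) (alpha : R[i]) (n j : nat) : R :=
  ginv (lambda alpha n j).

Definition cabs (R : realType) (z : R[i]) : R := ComplexField.Normc.normc z.

Definition kcoef (R : realType) (alpha : R[i]) : R :=
  (1 - cabs alpha ^+ 2) / cabs (1 + alpha) ^+ 2.

Definition lcoef (R : realType) (alpha : R[i]) : R :=
  cabs (1 - alpha) / cabs (1 + alpha).

Definition cot (R : realType) (x : R) : R := cos x / sin x.

(* The outer power has the integer exponent (-1) ^ j, i.e. 1 or -1. *)
Definition eta_interior (R : realType) (alpha : R[i]) (j : int) (x : R) : R :=
  - 2 * atan (((-1) ^ (j + 1) * kcoef alpha * cot x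
               + Num.sqrt (kcoef alpha ^+ 2 * cot x ^+ 2 + lcoef alpha ^+ 2))
              ^ ((-1 : int) ^ j)).

Definition eta (R : realType) (alpha : R[i]) (j : int) (x : R) : R :=
  if x == 0 then lim (eta_interior alpha j y @[y --> (0 : R)^'+])
  else if x == pi then lim (eta_interior alpha j y @[y --> (pi : R)^'-])
  else eta_interior alpha j x.

(* Main.v *)
Require Import Defs.
From mathcomp Require Import ring lra zify.

Import Order.TTheory GRing.Theory Num.Theory.
Import numFieldNormedType.Exports.
Local Open Scope complex_scope.
Local Open Scope ring_scope.

(** Write N = |alpha|^2 and r = Re alpha. On the curve lambda = g(x), that is
    lambda = 2 - 2 cos x, the characteristic polynomial of the matrix is, up to
    sign, the trigonometric function

      G(x) = (1 - N) cos x (sin(n x) / sin x) + (1 + N) cos(n x) - 2 r.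

    Since alpha is neither 1 nor -1, 1 + N - 2 r = |1 - alpha|^2 and
    1 + N + 2 r = |1 + alpha|^2 are positive; with N <= 1 this makes the sign of
    G at j pi / n equal to (-1)^j for every 0 <= j <= n ([char_trig_sign]). Hence
    each of the n open intervals ](j-1) pi / n, j pi / n[ contains a zero of G
    ([char_trig_root]).

    No determinant is computed: a zero x of G yields an explicit left
    eigenvector for g(x), built from the sequences sin(k x) and sin((k-1) x)
    ([char_trig_eigenvalue]). The n zeros thus give n distinct eigenvalues, which
    exhaust the roots of the characteristic polynomial, and as g is increasing
    the zero in the j-th interval is theta_j ([real_eigenvalues_sorted]).

    For that zero put z = (j pi - n x) / 2, a number of ]0, pi/2[. In terms of
    tan z the equation G(x) = 0 is quadratic, and tan z raised to the power
    (-1)^j is the positive root of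
      s^2 + 2 (-1)^j k cot(x) s = l^2
    ([half_angle_root]). Its closed form is the argument of the arctangent in
    eta, so that eta_j(x) = - 2 z, which is the asserted equation. Because the
    zero is strictly inside ]0, pi[, the limit values of eta do not occur. *)

Set Implicit Arguments.
Unset Strict Implicit.

(** * A trigonometric form of the characteristic polynomial *)

Lemma sinD_natpi (R : realType) (y : R) (m : nat) :
  sin (y + m%:R * pi) = (-1) ^+ m * sin y.
Proof.
elim: m => [|m IHm]; first by rewrite mul0r addr0 expr0 mul1r.
by rewrite -natr1 mulrDl mul1r addrA sinDpi IHm exprS mulN1r mulNr.
Qed.

Lemma cosD_natpi (R : realType) (y : R) (m : nat) :
  cos (y + m%:R * pi) = (-1) ^+ m * cos y.
Proof.
elim: m => [|m IHm]; first by rewrite mul0r addr0 expr0 mul1r.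
by rewrite -natr1 mulrDl mul1r addrA cosDpi IHm exprS mulN1r mulNr.
Qed.

Lemma sin_natpi (R : realType) (m : nat) : sin (m%:R * pi : R) = 0.
Proof. by have := sinD_natpi (0 : R) m; rewrite add0r sin0 mulr0. Qed.

Lemma cos_natpi (R : realType) (m : nat) : cos (m%:R * pi : R) = (-1) ^+ m.
Proof. by have := cosD_natpi (0 : R) m; rewrite add0r cos0 mulr1. Qed.

(** The quotient sin(m x) / sin x, i.e. the Chebyshev polynomial U_(m-1) at
    cos x, written as a recursion so that it is continuous also where sin x
    vanishes. *)
Fixpoint sin_ratio (R : realType) (m : nat) (x : R) : R :=
  if m is m'.+1 then sin_ratio m' x * cos x + cos (m'%:R * x) else 0.

Lemma sin_ratioE (R : realType) (m : nat) (x : R) :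
  sin_ratio m x * sin x = sin (m%:R * x).
Proof.
elim: m => [|m IHm] /=; first by rewrite !mul0r sin0.
by rewrite -natr1 [(_ + 1) * x]mulrDl mul1r sinD mulrDl mulrAC IHm.
Qed.

Lemma continuous_cosM (R : realType) (a : R) :
  continuous (fun x : R => cos (a * x)).
Proof.
move=> x; apply: (@continuous_comp _ _ _ ( *%R a) cos).
  exact: mulrl_continuous.
exact: continuous_cos.
Qed.

Lemma continuous_sin_ratio (R : realType) (m : nat) :
  continuous (@sin_ratio R m).
Proof.
elim: m => [|m IHm] x /=; first exact: cvg_cst.
apply: cvgD; last exact: continuous_cosM.
by apply: cvgM; [exact: IHm | exact: continuous_cos].
Qed.

Lemma sin_ratio0 (R : realType) (m : nat) : sin_ratio m (0 : R) = m%:R.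
Proof.
elim: m => [|m IHm] //=.
by rewrite IHm mulr0 cos0 mulr1 natr1.
Qed.

Lemma sin_ratiopi (R : realType) (m : nat) :
  sin_ratio m (pi : R) = - ((-1) ^+ m * m%:R).
Proof.
elim: m => [|m IHm] /=; first by rewrite mulr0 oppr0.
by rewrite IHm cospi cos_natpi -natr1 exprS; ring.
Qed.

(** The function G with N = |alpha|^2 and r = Re alpha. Dividing by sin x before
    looking for zeros removes the spurious zeros 0 and pi. *)
Definition char_trig (R : realType) (n : nat) (N r x : R) : R :=
  (1 - N) * (cos x * sin_ratio n x) + (1 + N) * cos (n%:R * x) - 2 * r.

Lemma continuous_char_trig (R : realType) (n : nat) (N r : R) :
  continuous (char_trig n N r).
Proof.
move=> x; apply: cvgB; last exact: cvg_cst.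
apply: cvgD; (apply: cvgM; first exact: cvg_cst); last first.
  exact: continuous_cosM.
by apply: cvgM; [exact: continuous_cos | exact: continuous_sin_ratio].
Qed.

(** At an interior node sin(n x) = 0, so only (1 + N) (-1)^j - 2 r remains. At
    the nodes 0 and pi the quotient sin(n x) / sin x is n up to sign, and its
    contribution n (1 - N) has the favourable sign. *)
Lemma char_trig_sign (R : realType) (n j : nat) (N r : R) :
  N <= 1 -> 2 * r < 1 + N -> - (2 * r) < 1 + N -> (0 < n)%N -> (j <= n)%N ->
  0 < (-1) ^+ j * char_trig n N r (j%:R * pi / n%:R).
Proof.
move=> N1 rlt rgt n_gt0 jn.
have n0 : n%:R != 0 :> R by rewrite pnatr_eq0 -lt0n.
have nn : n%:R * (j%:R * pi / n%:R) = j%:R * pi :> R by rewrite mulrC divfK.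
have e2 : (-1) ^+ j * (-1) ^+ j = 1 :> R.
  by rewrite -exprMn mulrNN mulr1 expr1n.
have Wge : 0 <= (-1) ^+ j *
    (cos (j%:R * pi / n%:R) * sin_ratio n (j%:R * pi / n%:R)) :> R.
  have [->|j_neq0] := eqVneq j 0%N.
    by rewrite !mul0r cos0 sin_ratio0 expr0 !mul1r.
  have [-> | jn_neq] := eqVneq j n.
    rewrite mulrAC divff // mul1r cospi sin_ratiopi mulN1r opprK mulrA.
    by rewrite -exprMn mulrNN mulr1 expr1n mul1r.
  have s_gt0 : 0 < sin (j%:R * pi / n%:R) :> R.
    apply: sin_gt0_pi; apply/andP; split.
      by rewrite divr_gt0 ?mulr_gt0 ?pi_gt0 ?ltr0n // lt0n.
    rewrite ltr_pdivrMr ?ltr0n // mulrC ltr_pM2l ?pi_gt0 // ltr_nat.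
    by rewrite ltn_neqAle jn_neq.
  have /eqP := sin_ratioE n (j%:R * pi / n%:R : R).
  by rewrite nn sin_natpi mulf_eq0 (gt_eqF s_gt0) orbF => /eqP ->; rewrite !mulr0.
rewrite /char_trig nn cos_natpi.
set e := (-1) ^+ j in e2 Wge *.
have -> : e * ((1 - N) * (cos (j%:R * pi / n%:R) *
   sin_ratio n (j%:R * pi / n%:R)) + (1 + N) * e - 2 * r) =
   (1 - N) * (e * (cos (j%:R * pi / n%:R) * sin_ratio n (j%:R * pi / n%:R))) +
   ((1 + N) * (e * e) - e * (2 * r)) by ring.
apply: ltr_wpDl; first by apply: mulr_ge0 => //; lra.
rewrite e2 /e -signr_odd; case: (odd j); rewrite ?expr0 ?expr1; lra.
Qed.

Lemma char_trig_root (R : realType) (n i : nat) (N r : R) :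
  N <= 1 -> 2 * r < 1 + N -> - (2 * r) < 1 + N -> (i < n)%N ->
  exists x, i%:R * pi < n%:R * x < i.+1%:R * pi /\ char_trig n N r x = 0.
Proof.
move=> N1 rlt rgt lt_in.
have n_gt0 : (0 < n)%N by apply: leq_ltn_trans lt_in.
have nr_gt0 : 0 < n%:R :> R by rewrite ltr0n.
have Sa := char_trig_sign N1 rlt rgt n_gt0 (ltnW lt_in).
have Sb := char_trig_sign N1 rlt rgt n_gt0 lt_in.
set a := i%:R * pi / n%:R in Sa; set b := i.+1%:R * pi / n%:R in Sb.
have le_ab : a <= b.
  rewrite ler_pM2r ?invr_gt0 // ler_pM2r ?pi_gt0 //.
  by rewrite ler_nat.
have cont : {within `[a, b], continuous (char_trig n N r)}%classic.
  by apply: continuous_subspaceT => x; apply: continuous_char_trig.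
have [|c /[!in_itv] /= /andP[ac cb] Gc] := IVT le_ab cont (v := 0).
  rewrite exprS mulN1r mulNr in Sb.
  move: Sa Sb; rewrite -signr_odd; case: (odd i) => /=;
    rewrite ?expr0 ?expr1 ?mulN1r ?mul1r ?opprK => Sa Sb;
    rewrite ge_min le_max; apply/andP; split; apply/orP; lra.
exists c; split => //; apply/andP; split.
  rewrite (mulrC n%:R) -ltr_pdivrMr // -/a lt_neqAle ac andbT.
  by apply: contraTneq Sa => ->; rewrite Gc mulr0 ltxx.
rewrite (mulrC n%:R) -ltr_pdivlMr // -/b lt_neqAle cb andbT.
by apply: contraTneq Sb => <-; rewrite Gc mulr0 ltxx.
Qed.

(** * Eigenvectors and the list of eigenvalues *)

Lemma sum_delta (S : pzRingType) (n k : nat) (F : nat -> S) :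
  \sum_(i < n) F i * (i == k :> nat)%:R = if (k < n)%N then F k else 0.
Proof.
case: ifP => [kn|/negbT nkn]; last first.
  rewrite big1 // => i _; have := ltn_ord i.
  by case: eqP => [->|_ _]; rewrite ?(negPf nkn) // mulr0.
rewrite (bigD1 (Ordinal kn)) //= eqxx mulr1 big1 ?addr0 // => i ik.
have -> : (i == k :> nat) = false by apply: contraNF ik => /eqP e; apply/eqP/val_inj.
by rewrite mulr0.
Qed.

(** The vector w_1, ..., w_n is extended by w_0 and w_(n+1): the corner entries of
    the matrix then act as the two boundary conditions, and every column of the
    eigenvalue equation becomes the same three-term recurrence. *)
Lemma Amx_eigenvector (R : realType) (alpha t : R[i]) (n : nat)
    (w : nat -> R[i]) :
  (3 <= n)%N ->
  (forall k, w k + w k.+2 = t * w k.+1) ->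
  w 0%N = alpha * w n -> w n.+1 = alpha^* * w 1%N ->
  (\row_(i < n) w i.+1) *m Amx alpha n = (2 - t) *: \row_(i < n) w i.+1.
Proof.
move=> n3 rec w0 wn; apply/rowP => j; rewrite !mxE.
have -> : (2 - t) * w j.+1 = 2 * w j.+1 - w j - w j.+2.
  by rewrite mulrBl -rec opprD addrA.
have jn := ltn_ord j.
(* Each entry is a combination of indicators of the row index; the two extra
   factors in j switch off the terms that fall outside the matrix. *)
have E (i : 'I_n) : (\row_(i < n) w i.+1) 0 i * Amx alpha n i j =
   2 * (w i.+1 * (i == j :> nat)%:R)
   - (w i.+1 * (i == j.-1 :> nat)%:R) * (0 < j)%N%:R
   - (w i.+1 * (i == j.+1 :> nat)%:R)
   - alpha^* * (w i.+1 * (i == 0 :> nat)%:R) * (j == n.-1 :> nat)%:R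
   - alpha * (w i.+1 * (i == n.-1 :> nat)%:R) * (j == 0 :> nat)%:R.
  have := ltn_ord i; rewrite !mxE -(inj_eq val_inj) /= => lin.
  case: (posnP j) => [j0|j0];
  do ! [match goal with |- context [@eq_op _ ?a ?b] =>
    match type of a with nat => case: (@eqP _ a b) => ? | _ => fail end
    end; try (exfalso; lia)].
  all: rewrite ?mulr0 ?mulr1 ?subr0 ?add0r ?sub0r /=.
  all: try ring.
rewrite (eq_bigr _ (fun i _ => E i)) !sumrB -!mulr_sumr -!mulr_suml.
rewrite -!mulr_sumr !(@sum_delta _ n _ (fun i => w i.+1)) jn.
have -> : (0 < n)%N by lia.
have -> : (j.-1 < n)%N by lia.
have -> : (n.-1 < n)%N by lia.
have -> : n.-1.+1 = n by lia.
have [->|j_neq0] := eqVneq (j : nat) 0%N.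
  have -> : (1 < n)%N by lia.
  have -> : (0 == n.-1)%N = false by lia.
  by rewrite w0 /=; ring.
have -> : (0 < j)%N by lia.
have -> : j.-1.+1 = j by lia.
have [jl|j_neqn] := eqVneq (j : nat) n.-1.
  have -> : (j.+1 < n)%N = false by lia.
  have -> : j.+2 = n.+1 by lia.
  by rewrite wn /=; ring.
have -> : (j.+1 < n)%N by lia.
by rewrite /=; ring.
Qed.

Lemma mulC_conj (R : realType) (p q : R) :
  (p +i* q) * (p +i* q)^* = (p ^+ 2 + q ^+ 2)%:C.
Proof. by apply/eqP; rewrite eq_complex /=; apply/andP; split; apply/eqP; ring. Qed.

Lemma addC_conj (R : realType) (p q : R) :
  (p +i* q) + (p +i* q)^* = (2 * p)%:C.
Proof. by apply/eqP; rewrite eq_complex /=; apply/andP; split; apply/eqP; ring. Qed.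

(** The recurrence w_k + w_(k+2) = 2 cos x w_(k+1) is solved by any combination of
    sin(k x) and sin((k-1) x). The coefficients below are chosen to satisfy the
    boundary condition at 0; the condition at n+1 then amounts to
    sin x G(x) = 0. The assumption that sin(n x) does not vanish ensures that
    the vector is nonzero. *)
Lemma char_trig_eigenvalue (R : realType) (p q x : R) (n : nat) :
  (3 <= n)%N -> 0 < sin x -> sin (n%:R * x) != 0 ->
  char_trig n (p ^+ 2 + q ^+ 2) p x = 0 ->
  eigenvalue (Amx (p +i* q) n) (2 - 2 * cos x)%:C.
Proof.
move=> n3 s1 sn Gx.
have aa' := mulC_conj p q; have apa' := addC_conj p q.
set a := p +i* q in aa' apa' *.
set N := p ^+ 2 + q ^+ 2 in aa' Gx.
have s1C : (sin x)%:C != 0 :> R[i] by rewrite fmorph_eq0 gt_eqF.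
have snC : (sin (n%:R * x))%:C != 0 :> R[i] by rewrite fmorph_eq0.
pose S y : R[i] := (sin y)%:C.
pose w k := (S x + a * S (n%:R * x - x)) * S (k%:R * x)
            - a * S (n%:R * x) * S (k%:R * x - x).
have Srec (y : R) : S (y + x + x) = (2 * cos x)%:C * S (y + x) - S y.
  rewrite -rmorphM -rmorphB /=; congr (_%:C); rewrite !sinD !cosD.
  have : sin x ^+ 2 = 1 - cos x ^+ 2 by rewrite -(cos2Dsin2 x); ring.
  by move=> e; ring: e.
have rec k : w k + w k.+2 = (2 * cos x)%:C * w k.+1.
  have e k' : k'.+1%:R * x = k'%:R * x + x by rewrite -natr1 mulrDl mul1r.
  have r2 := Srec (k%:R * x - x); rewrite subrK in r2.
  by rewrite /w !e !addrK Srec r2; ring.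
have w0 : w 0%N = a * w n.
  by rewrite /w !mul0r sub0r /S sin0 sinN rmorphN rmorph0 /=; ring.
have w1E : w 1%N = (S x + a * S (n%:R * x - x)) * S x.
  by rewrite /w (mul1r x) subrr /S sin0 rmorph0; ring.
(* G(x) = 0 multiplied by sin x. *)
have FG : (1 - N) * cos x * sin (n%:R * x) + (1 + N) * cos (n%:R * x) * sin x
    = 2 * p * sin x.
  apply/eqP; rewrite -subr_eq0; apply/eqP.
  by rewrite -sin_ratioE -[RHS](mul0r (sin x)) -Gx /char_trig; ring.
have trig_id (y : R) : sin y ^+ 2 = 1 - cos y ^+ 2.
  by rewrite -(cos2Dsin2 y); ring.
have wn : w n.+1 = a^* * w 1%N.
  rewrite w1E /w -natr1 [(_ + 1) * x]mulrDl (mul1r x) addrK.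
  (* sin((n+1)x) sin((n-1)x) - sin(nx)^2 = - sin(x)^2 *)
  have e1 : S (n%:R * x + x) * S (n%:R * x - x) - S (n%:R * x) ^+ 2 = - S x ^+ 2.
    rewrite -!rmorphXn -!rmorphM -rmorphB -rmorphN /=; congr (_%:C).
    rewrite sinD sinB.
    have := trig_id x; have := trig_id (n%:R * x) => t1 t2.
    by ring: t1 t2.
  have e2 : S (n%:R * x + x) - N%:C * S (n%:R * x - x) = (2 * p)%:C * S x.
    rewrite -!rmorphM -rmorphB /=; congr (_%:C); rewrite -FG sinD sinB.
    by ring.
  apply/eqP; rewrite -subr_eq0; apply/eqP.
  transitivity (S x * (S (n%:R * x + x) - (a * a^*) * S (n%:R * x - x))
     + a * (S (n%:R * x + x) * S (n%:R * x - x) - S (n%:R * x) ^+ 2)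
     - a^* * S x ^+ 2); first by ring.
  by rewrite aa' e1 e2 -apa'; ring.
have wE := Amx_eigenvector n3 rec w0 wn.
have -> : (2 - 2 * cos x)%:C = 2 - (2 * cos x)%:C.
  by rewrite rmorphB rmorphMn rmorph1.
apply/eigenvalueP; exists (\row_(i < n) w i.+1) => //.
apply/eqP => /rowP v0.
have v i : (i < n)%N -> w i.+1 = 0.
  by move=> lin; have := v0 (Ordinal lin); rewrite !mxE.
have w1 : w 1%N = 0 by apply: v; lia.
have w2 : w 2%N = 0 by apply: v; lia.
have c0 : S x + a * S (n%:R * x - x) = 0.
  by move/eqP: w1; rewrite w1E mulf_eq0 (negPf s1C) orbF => /eqP.
have a0 : a = 0.
  have xE : 2%:R * x - x = x by ring.
  move: w2; rewrite /w c0 mul0r sub0r xE.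
  by move/eqP; rewrite oppr_eq0 !mulf_eq0 (negPf s1C) (negPf snC) !orbF => /eqP.
by move: c0; rewrite a0 mul0r addr0 => /eqP; rewrite (negPf s1C).
Qed.

(** A monic polynomial of degree n with n distinct known roots is determined, and
    a sorted list is determined by the multiset of its entries. *)
Lemma real_eigenvalues_sorted (R : realType) (n : nat) (M : 'M[R[i]]_n)
    (s : seq R) :
  sorted <%R s -> size s = n -> {in s, forall y, eigenvalue M y%:C} ->
  real_eigenvalues M = s.
Proof.
move=> s_lt sz ev.
have Ms : char_poly M = \prod_(x <- s) ('X - (x%:C)%:P).
  rewrite (@all_roots_prod_XsubC _ (char_poly M) [seq y%:C | y <- s]).
  - by rewrite (monicP (char_poly_monic M)) scale1r big_map.
  - by rewrite size_char_poly size_map sz.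
  - by apply/allP => _ /mapP[y ys ->]; rewrite -eigenvalue_root_char ev.
  - by rewrite uniq_rootsE map_inj_uniq ?(lt_sorted_uniq s_lt) //; exact: complexI.
apply: xget_unique => [|s' [s'_le]].
  by split => //; have /andP[] := lt_sorted_is_uniq_le s_lt.
rewrite Ms -(big_map _ xpredT (fun z => 'X - z%:P)).
rewrite -[RHS](big_map (real_complex R) xpredT (fun z => 'X - z%:P)).
move=> /prod_XsubC_eq /(perm_map_inj (@complexI _)); rewrite perm_sym.
apply: le_sorted_eq => //.
by have /andP[] := lt_sorted_is_uniq_le s_lt.
Qed.

Lemma gE (R : realType) (x : R) : g x = 2 - 2 * cos x.
Proof.
have := cos_mulr2n (x / 2).
rewrite -[(x / 2) *+ 2]mulr_natr divfK ?pnatr_eq0 // => cosE.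
have := cos2Dsin2 (x / 2) => pyth.
by rewrite cosE /g; lra.
Qed.

Lemma ltr_g (R : realType) :
  {in `[0, pi] &, {homo @g R : x y / x < y}}.
Proof. by move=> x y xI yI; rewrite -ltr_cos // !gE; lra. Qed.

Lemma ginvK (R : realType) : {in `[0, pi], cancel (@g R) (@ginv R)}.
Proof.
move=> x xI; apply: pinvKV; last by rewrite inE /=; move: xI; rewrite in_itv.
move=> y z; rewrite !inE /= => yI zI; rewrite !gE => e.
by apply: cos_inj; rewrite ?in_itv //=; lra.
Qed.

(** * The half-angle equation *)

(** The two roots have the negative product - c, so positivity selects the one
    with the plus sign. *)
Lemma pos_quadratic_root (R : rcfType) (b c s : R) :
  0 < s -> 0 < c -> s ^+ 2 + 2 * b * s = c -> s = - b + Num.sqrt (b ^+ 2 + c).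
Proof.
move=> s_gt0 c_gt0 c_def; rewrite -{c}c_def in c_gt0 *.
have sb_gt0 : 0 < s + b.
  have e : s ^+ 2 + 2 * b * s = s * (s + 2 * b) by ring.
  by move: c_gt0; rewrite e pmulr_rgt0 //; lra.
have -> : b ^+ 2 + (s ^+ 2 + 2 * b * s) = (s + b) ^+ 2 by ring.
by rewrite sqrtr_sqr gtr0_norm //; ring.
Qed.

(** With X = j pi - 2 z one has sin X = - (-1)^j sin(2 z) and
    cos X = (-1)^j cos(2 z). Writing 2 r as 2 r (cos^2 z + sin^2 z) makes the
    equation homogeneous of degree 2 in (cos z, sin z). For even j, dividing by
    cos^2 z gives a quadratic equation in tan z; for odd j, dividing by sin^2 z
    gives one in 1 / tan z. This is the origin of the exponent (-1)^j. *)
Lemma half_angle_root (R : realType) (N r c z : R) (j : nat) :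
  2 * r < 1 + N -> - (2 * r) < 1 + N -> 0 < z < pi / 2 ->
  (1 - N) * c * sin (j%:R * pi - 2 * z) + (1 + N) * cos (j%:R * pi - 2 * z)
    = 2 * r ->
  tan z ^ ((-1 : int) ^ j%:Z) =
    (-1) ^ (j%:Z + 1) * ((1 - N) / (1 + N + 2 * r)) * c
    + Num.sqrt (((1 - N) / (1 + N + 2 * r)) ^+ 2 * c ^+ 2
                + (1 + N - 2 * r) / (1 + N + 2 * r)).
Proof.
move=> rlt rgt z_itv.
have C0 : 0 < cos z by apply: cos_gt0_pihalf; have := pi_gt0 R; lra.
have S0 : 0 < sin z by apply: sin_gt0_pihalf.
have D0 : 0 < 1 + N + 2 * r by lra.
have E0 : 0 < 1 + N - 2 * r by lra.
have D1 : 1 + N + 2 * r != 0 by rewrite gt_eqF.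
have C1 : cos z != 0 by rewrite gt_eqF.
have S1 : sin z != 0 by rewrite gt_eqF.
have pyth := cos2Dsin2 z.
have z2 : 2 * z = z + z by ring.
have -> : j%:R * pi - 2 * z = - (2 * z) + j%:R * pi by ring.
rewrite sinD_natpi cosD_natpi sinN cosN z2 sinD cosD.
have -> : (-1 : R) ^ (j%:Z + 1) = - (-1) ^+ j.
  by rewrite expN1r -PoszD absz_nat addn1 exprS mulN1r.
rewrite -[(-1 : int) ^ j%:Z]/((-1 : int) ^+ j).
rewrite -(signr_odd R) -(signr_odd int).
set k := (1 - N) / _; have kE : k * (1 + N + 2 * r) = 1 - N by rewrite divfK.
set l2 := _ / (1 + N + 2 * r).
have lE : l2 * (1 + N + 2 * r) = 1 + N - 2 * r by rewrite divfK.
have l2_gt0 : 0 < l2 by rewrite divr_gt0.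
have r_split : 2 * r = 2 * r * (cos z ^+ 2 + sin z ^+ 2) by rewrite pyth mulr1.
case: (odd j); rewrite ?expr0 ?expr1 => eq0.
  rewrite exprN1 /tan invf_div.
  have -> : - (-1) * k * c = - (- (k * c)) by ring.
  rewrite -exprMn -sqrrN.
  apply: pos_quadratic_root; rewrite ?divr_gt0 //.
  have DS0 : (1 + N + 2 * r) * sin z ^+ 2 != 0 by rewrite mulf_neq0 ?expf_neq0.
  apply: (mulIf DS0); rewrite [RHS]mulrA lE.
  transitivity ((1 + N + 2 * r) * cos z ^+ 2
      - 2 * (k * (1 + N + 2 * r)) * c * sin z * cos z); first by field.
  by rewrite kE; lra.
rewrite expr1z /tan mulN1r -exprMn mulNr.
apply: pos_quadratic_root; rewrite ?divr_gt0 //.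
have DC0 : (1 + N + 2 * r) * cos z ^+ 2 != 0 by rewrite mulf_neq0 ?expf_neq0.
apply: (mulIf DC0); rewrite [RHS]mulrA lE.
transitivity ((1 + N + 2 * r) * sin z ^+ 2
    + 2 * (k * (1 + N + 2 * r)) * c * sin z * cos z); first by field.
by rewrite kE; lra.
Qed.

(** As n x lies between (j-1) pi and j pi, the half-angle z below lies in
    ]0, pi/2[, where atan inverts tan. *)
Lemma eta_interior_eq (R : realType) (p q x : R) (n j : nat) :
  let N := p ^+ 2 + q ^+ 2 in
  2 * p < 1 + N -> - (2 * p) < 1 + N -> (0 < j)%N -> 0 < x < pi ->
  j.-1%:R * pi < n%:R * x < j%:R * pi -> char_trig n N p x = 0 ->
  n%:R * x = j%:R * pi + eta_interior (p +i* q) j%:Z x.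
Proof.
move=> N rlt rgt j0 x_itv nx_itv Gx.
pose z := (j%:R * pi - n%:R * x) / 2.
have jE : j%:R * pi = j.-1%:R * pi + pi :> R.
  by rewrite -{1}(prednK j0) -natr1 mulrDl mul1r.
have z_itv : 0 < z < pi / 2 by rewrite /z; move: nx_itv; rewrite jE; lra.
have s_gt0 : 0 < sin x by apply: sin_gt0_pi.
have XE : n%:R * x = j%:R * pi - 2 * z by rewrite /z; field.
have cabsE (u v : R) : cabs (u +i* v) ^+ 2 = u ^+ 2 + v ^+ 2.
  by rewrite /cabs /= sqr_sqrtr // addr_ge0 // sqr_ge0.
have DE : cabs (1 + (p +i* q)) ^+ 2 = 1 + N + 2 * p.
  have -> : 1 + (p +i* q) = (1 + p) +i* q.
    by apply/eqP; rewrite eq_complex /= add0r !eqxx.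
  by rewrite cabsE /N; ring.
have EE : cabs (1 - (p +i* q)) ^+ 2 = 1 + N - 2 * p.
  have -> : 1 - (p +i* q) = (1 - p) +i* (- q).
    by apply/eqP; rewrite eq_complex /= sub0r !eqxx.
  by rewrite cabsE /N; ring.
have kE : kcoef (p +i* q) = (1 - N) / (1 + N + 2 * p).
  by rewrite /kcoef DE cabsE.
have lE : lcoef (p +i* q) ^+ 2 = (1 + N - 2 * p) / (1 + N + 2 * p).
  by rewrite /lcoef expr_div_n DE EE.
have := @half_angle_root R N p (cot x) z j rlt rgt z_itv.
rewrite -XE => H.
rewrite /eta_interior kE lE -H; last first.
  rewrite /cot -sin_ratioE.
  have /eqP := Gx; rewrite /char_trig subr_eq0 => /eqP <-.
  by field; rewrite gt_eqF.
(* The exponent is its own inverse, so the power in eta restores tan z. *)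
set e := ((-1 : int) ^ j%:Z)%R.
have -> : (tan z ^ e) ^ e = tan z.
  rewrite exprz_exp /e -exprMz_comm //.
  by rewrite mulrNN mulr1 exp1rz expr1z.
rewrite tanK ?in_itv /=; first by rewrite mulNr XE.
by have := pi_gt0 R; lra.
Qed.

(** * The equation for the eigenvalues *)

Unset Implicit Arguments.
Theorem theorem2 (R : realType) (alpha : R[i]) (n j : nat)
    (halpha : cabs alpha <= 1) (halpha_m1 : alpha <> -1) (halpha_1 : alpha <> 1)
    (hn : (3 <= n)%N) (hj : (1 <= j <= n)%N) :
  vartheta alpha n j
    = (j%:R * pi + eta alpha j%:Z (vartheta alpha n j)) / n%:R.
Proof.
case: alpha halpha halpha_m1 halpha_1 => p q halpha halpha_m1 halpha_1.
pose N := p ^+ 2 + q ^+ 2.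
have N1 : N <= 1.
  by move: halpha; rewrite /cabs /= -/N -[X in _ <= X]sqrtr1 ler_sqrt.
have rgt : - (2 * p) < 1 + N.
  have e : 1 + N + 2 * p = (1 + p) ^+ 2 + q ^+ 2 by rewrite /N; ring.
  suff : 0 < 1 + N + 2 * p by lra.
  rewrite e lt_neqAle addr_ge0 ?sqr_ge0 // andbT eq_sym paddr_eq0 ?sqr_ge0 //.
  rewrite !sqrf_eq0 addrC addr_eq0; apply/negP => /andP[/eqP pE /eqP qE].
  by apply: halpha_m1; rewrite pE qE; apply/eqP; rewrite eq_complex /= oppr0 !eqxx.
have rlt : 2 * p < 1 + N.
  have e : 1 + N - 2 * p = (1 - p) ^+ 2 + q ^+ 2 by rewrite /N; ring.
  suff : 0 < 1 + N - 2 * p by lra.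
  rewrite e lt_neqAle addr_ge0 ?sqr_ge0 // andbT eq_sym paddr_eq0 ?sqr_ge0 //.
  rewrite !sqrf_eq0 subr_eq0; apply/negP => /andP[/eqP pE /eqP qE].
  by apply: halpha_1; rewrite -pE qE.
have n_gt0 : 0 < n%:R :> R by rewrite ltr0n; lia.
pose P i x := (i < n)%N ->
  i%:R * pi < n%:R * x < i.+1%:R * pi /\ char_trig n N p x = 0.
(* xs i is the zero in the interval of index i, counted from 0. *)
have [xs xsP] : {xs : nat -> R & forall i, P i (xs i)}.
  apply: choice => i; rewrite /P; case: (ltnP i n) => [lin|_].
    by have [x xP] := char_trig_root N1 rlt rgt lin; exists x.
  by exists 0.
have xs_itv i : (i < n)%N -> 0 < xs i < pi.
  move=> lin; have [/andP[lo hi] _] := xsP i lin.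
  apply/andP; split.
    rewrite -(pmulr_rgt0 _ n_gt0); apply: le_lt_trans lo.
    by rewrite mulr_ge0 ?ler0n ?pi_ge0.
  rewrite -(ltr_pM2l n_gt0); apply: lt_le_trans hi _.
  by rewrite ler_pM2r ?pi_gt0 // ler_nat.
have xs_cc i : (i < n)%N -> xs i \in `[0, pi].
  by move=> /xs_itv /andP[lo hi]; rewrite in_itv /= !ltW.
have xs_lt : {in gtn n &, {homo xs : i k / (i < k)%N >-> i < k}}.
  move=> i k; rewrite !inE => lin lkn lik.
  have [/andP[_ hi] _] := xsP i lin; have [/andP[lo _] _] := xsP k lkn.
  rewrite -(ltr_pM2l n_gt0); apply: (lt_trans hi); apply: le_lt_trans lo.
  by rewrite ler_pM2r ?pi_gt0 // ler_nat.
have sin_neq0 i : (i < n)%N -> sin (n%:R * xs i) != 0.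
  move=> lin; have [/andP[lo hi] _] := xsP i lin.
  rewrite -[n%:R * xs i](subrK (i%:R * pi)) sinD_natpi mulf_neq0 ?signr_eq0 //.
  rewrite gt_eqF // sin_gt0_pi //.
  by move: hi; rewrite -natr1 mulrDl mul1r; lra.
have spec : real_eigenvalues (Amx (p +i* q) n) = [seq g (xs i) | i <- iota 0 n].
  apply: real_eigenvalues_sorted.
  - apply: (homo_sorted_in (P := gtn n) (e := ltn)) (iota_ltn_sorted 0 n).
      move=> i k lin lkn lik; apply: ltr_g; rewrite ?xs_cc //.
      exact: xs_lt.
    by apply/allP => i; rewrite mem_iota.
  - by rewrite size_map size_iota.
  - move=> _ /mapP[i + ->]; rewrite mem_iota /= => lin.
    rewrite gE; apply: char_trig_eigenvalue => //.
    + by rewrite sin_gt0_pi // xs_itv.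
    + exact: sin_neq0.
    + by have [_] := xsP i lin.
case/andP: hj => j_gt0 le_jn.
have lin : (j.-1 < n)%N by lia.
have -> : vartheta (p +i* q) n j = xs j.-1.
  rewrite /vartheta /lambda spec (nth_map 0%N) ?size_iota // nth_iota // add0n.
  by rewrite ginvK // xs_cc.
have [x_itv Gx] := xsP _ lin; have x_pi := xs_itv _ lin.
rewrite prednK // in x_itv.
have /andP[x0 xpi] := x_pi.
rewrite /eta gt_eqF // lt_eqF //.
rewrite -(eta_interior_eq rlt rgt j_gt0 x_pi x_itv Gx).
by rewrite mulrC mulKf // gt_eqF.
Qed.
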